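(* Let $\mathbf{W}(k)=\lim_{n\to\infty}\mathrm{wR}(n,k)$ denote the weighted Ramsey limit. Then: (i) For every integer $k\ge 5$, $$1.051\left\lfloor\frac{k^2}{4}\right\rfloor<\mathbf{W}(k)\le 1.25\left\lfloor\frac{k^2}{4}\right\rfloor .$$ (ii) There is an integer $k_0$ such that for all integers $k\ge k_0$, $$\mathbf{W}(k)>1.059\left\lfloor\frac{k^2}{4}\right\rfloor .$$ (iii) For $k\in\{4,5,6,7,8\}$, $L(k)\le \mathbf{W}(k)\le U(k)$, where $L(4)=4.1999$, $U(4)=4.8$; $L(5)=6.3572$, $U(5)=7.5$; $L(6)=9.5197$, $U(6)=11.25$; $L(7)=12.7091$, $U(7)=15$; $L(8)=16.9115$, $U(8)=20$.
   Context: For integers $3\le k\le n$, the weighted Ramsey number $\mathrm{wR}(n,k)$ is the minimum $q$ such that there is an assignment of nonnegative real numbers (weights) to the edges of the complete graph $K_n$ with total sum of weights equal to $\binom{n}{2}$, and a Red/Blue coloring of the edges of the same $K_n$, such that in every complete $k$-vertex subgraph $H$ of $K_n$, the sum of the weights on Red edges of $H$ is at most $q$ and the sum of the weights on Blue edges of $H$ is at most $q$. The weighted Ramsey limit is $\mathbf{W}(k):=\lim_{n\to\infty}\mathrm{wR}(n,k)$; this limit exists because $\mathrm{wR}(n,k)$ is nondecreasing in $n$ and bounded above by $\binom{k}{2}$. *)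

(* Defs.v *)
From mathcomp Require Import all_boot all_order all_algebra.
From mathcomp Require Import all_classical all_reals all_analysis.

Set Implicit Arguments.
Unset Strict Implicit.
Unset Printing Implicit Defensive.

Import Order.TTheory GRing.Theory Num.Theory.
Import numFieldNormedType.Exports.

Local Open Scope classical_set_scope.
Local Open Scope ring_scope.

(* The edges of the complete graph with vertex set H are the 2-element subsets
   of H; the edges of K_n are [edges [set: 'I_n]]. *)
Definition edges (n : nat) (H : {set 'I_n}) : {set {set 'I_n}} :=
  [set e : {set 'I_n} | (e \subset H) && (#|e| == 2%N)]%SET.

(* A Red/Blue coloring is given by its set [red] of Red edges; every other edge
   is Blue. The values of w and red at sets that are not edges are never used. *)
Definition admissible (R : realType) (n k : nat) (q : R) : Prop :=
  exists (w : {set 'I_n} -> R) (red : {set {set 'I_n}}),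
    [/\ forall e, e \in edges [set: 'I_n]%SET -> 0 <= w e,
        \sum_(e in edges [set: 'I_n]%SET) w e = 'C(n, 2)%:R &
        forall H : {set 'I_n}, #|H| = k ->
          \sum_(e in edges H | e \in red) w e <= q /\
          \sum_(e in edges H | e \notin red) w e <= q].

(* The infimum is attained when 3 <= k <= n, see [wR_min] below. *)
Definition wR (R : realType) (n k : nat) : R := inf [set q | admissible n k q].

(* The limit exists when 3 <= k, see [wR_cvg] below. *)
Definition W (R : realType) (k : nat) : R := limn (fun n => wR R n k).

Section WellDefined.
Variable R : realType.
Implicit Types (n k : nat) (q : R).

Let eq_leR (x y : R) : x = y -> x <= y. Proof. by move=> ->. Qed.

Lemma edgesS n (H H' : {set 'I_n}) : H \subset H' -> edges H \subset edges H'.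
Proof.
move=> HH'; apply/fintype.subsetP => e; rewrite !inE => /andP[eH ->].
by rewrite (fintype.subset_trans eH HH').
Qed.

Lemma card_edges n (H : {set 'I_n}) : #|edges H| = 'C(#|H|, 2).
Proof. by rewrite -cards_draws; apply: eq_card => e; rewrite !inE. Qed.

Lemma edge_sum_le n (w : {set 'I_n} -> R) (H : {set 'I_n}) (P : pred {set 'I_n}) :
  (forall e, e \in edges [set: 'I_n]%SET -> 0 <= w e) ->
  \sum_(e in edges H | P e) w e <= \sum_(e in edges [set: 'I_n]%SET) w e.
Proof.
move=> w0; rewrite big_mkcondr /=.
have sH e : e \in edges H -> e \in edges [set: 'I_n]%SET.
  by apply/fintype.subsetP; exact/edgesS/finset.subsetT.
rewrite [leRHS](bigID (mem (edges H))) /= ler_wpDr//.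
  by apply: sumr_ge0 => e /andP[/w0].
rewrite [leRHS](eq_bigl (mem (edges H))); last first.
  by move=> e /=; rewrite andbC; case: (boolP (e \in edges H)) => //= /sH.
by apply: ler_sum => e /sH /w0; case: ifP.
Qed.

Lemma admissible_min n k q :
  admissible n k q -> admissible n k (Num.min q 'C(n, 2)%:R).
Proof.
move=> [w [r [w0 ws h]]]; exists w, r; split=> // H /h[h1 h2].
by rewrite !le_min h1 h2 -ws; split; apply: edge_sum_le.
Qed.

Lemma admissible_bin n k : admissible n k ('C(k, 2)%:R : R).
Proof.
exists (fun=> 1), finset.set0; split=> [||H Hk].
- by move=> e _; exact: ler01.
- by rewrite sumr_const card_edges cardsT card_ord.
have E : \sum_(e in edges H) (1 : R) = 'C(k, 2)%:R.
  by rewrite sumr_const card_edges Hk.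
by split; rewrite -E [leLHS]big_mkcondr; apply: ler_sum => e _; case: ifP.
Qed.

Lemma admissible_ge0 n k q : (k <= n)%N -> admissible n k q -> 0 <= q.
Proof.
move=> kn [w [r [w0 ws h]]].
have [H Hk] : exists H : {set 'I_n}, #|H| = k.
  have : (0 < #|[set A : {set 'I_n} | #|A| == k]%SET|)%N.
    by rewrite card_draws card_ord bin_gt0.
  by case/card_gt0P => H; rewrite inE => /eqP; exists H.
have [+ _] := h H Hk; apply: le_trans; apply: sumr_ge0 => e /andP[eH _].
by apply: w0; apply: (fintype.subsetP (edgesS (finset.subsetT H))).
Qed.

Lemma admissible_lbound n k : (k <= n)%N ->
  has_lbound [set q : R | admissible n k q].
Proof. by move=> kn; exists 0 => q /= /(admissible_ge0 kn). Qed.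

Lemma admissible_pred n k q : (2 <= n)%N ->
  admissible n.+1 k q -> admissible n k q.
Proof.
move=> n2 [w [r [w0 ws h]]].
pose g (v : 'I_n.+1) (e : {set 'I_n}) : {set 'I_n.+1} := (lift v @: e)%SET.
have gI v : injective (g v) by exact/imset_inj/lift_inj.
have g_card v e : #|g v e| = #|e| by rewrite card_imset //; exact: lift_inj.
have gE v (H : {set 'I_n}) : edges (g v H) = (g v @: edges H)%SET.
  apply/esym/eqP; rewrite eqEcard card_imset// !card_edges g_card leqnn andbT.
  apply/fintype.subsetP => _ /imsetP[e + ->]; rewrite !inE g_card.
  by move=> /andP[eH ->]; rewrite imsetS.
have gsum v (H : {set 'I_n}) (P : pred {set 'I_n.+1}) :
    \sum_(e in edges H | P (g v e)) w (g v e) =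
    \sum_(e in edges (g v H) | P e) w e.
  by rewrite gE !big_mkcondr /= big_imset// => x y _ _; exact: gI.
have gT v e : (e \in edges (g v [set: 'I_n]%SET)) =
    (e \in edges [set: 'I_n.+1]%SET) && (v \notin e).
  rewrite !inE finset.subsetT /= andbC; congr (_ && _).
  apply/fintype.subsetP/idP => [sub|ve x xe].
    by apply/negP => /sub /imsetP[x _ /eqP]; rewrite (negbTE (neq_lift v x)).
  case: (unliftP v x) => [y ->|xv]; first by rewrite imset_f ?inE.
  by rewrite xv (negbTE ve) in xe.
pose s v := \sum_(e in edges [set: 'I_n]%SET) w (g v e).
have s_sum : \sum_v s v = 'C(n.+1, 2)%:R * n.-1%:R.
  rewrite (eq_bigr (fun v => \sum_(e in edges [set: 'I_n.+1]%SET | v \notin e) w e)).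
    rewrite (exchange_big_dep (mem (edges [set: 'I_n.+1]%SET))) /=; last first.
      by move=> v e _ /andP[].
    rewrite -ws mulr_suml; apply: eq_bigr => e eE.
    rewrite sumr_const mulr_natr; congr (_ *+ _).
    have -> : n.-1 = #|(~: e)%SET|.
      rewrite cardsCs finset.setCK card_ord; move: eE.
      by rewrite inE => /andP[_ /eqP ->]; rewrite subSS subn1.
    apply: eq_card => v; rewrite finset.in_setC unfold_in /=.
    by rewrite eE.
  move=> v _; rewrite -(eq_bigl _ _ (gT v)) gE big_imset// => x y _ _.
  exact: gI.
have [v sv] : exists v, 'C(n, 2)%:R <= s v.
  apply/not_existsP => sl.
  have : \sum_v s v < \sum_(v : 'I_n.+1) 'C(n, 2)%:R.
    apply: ltr_sum; first by apply/hasP; exists ord0; rewrite ?mem_index_enum.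
    by move=> v _; rewrite ltNge; apply/negP/sl.
  rewrite s_sum sumr_const card_ord -natrM -mulrnA ltr_nat.
  have -> : ('C(n.+1, 2) * n.-1 = 'C(n, 2) * n.+1)%N.
    apply/eqP; rewrite -(@eqn_pmul2l 2)// !mulnA !mul_bin_left !bin1 subn1 /=.
    by rewrite subn1 mulnAC [(n * _)%N]mulnC.
  by rewrite ltnn.
have C0 : 0 < 'C(n, 2)%:R :> R by rewrite ltr0n bin_gt0.
have s0 : 0 < s v by exact: lt_le_trans sv.
pose a := 'C(n, 2)%:R / s v.
have a0 : 0 <= a by rewrite divr_ge0// ltW.
have a1 : a <= 1 by rewrite ler_pdivrMr// mul1r.
have gw e : e \in edges [set: 'I_n]%SET -> 0 <= w (g v e).
  by move=> eE; apply: w0; have := imset_f (g v) eE; rewrite -gE gT => /andP[].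
exists (fun e => a * w (g v e)), [set e | g v e \in r]%SET; split.
- by move=> e /gw; exact: mulr_ge0.
- by rewrite -mulr_sumr -/(s v) divfK// gt_eqF.
move=> H Hk; have [|hr hb] := h (g v H); first by rewrite g_card.
have aw P : \sum_(e in edges H | P (g v e)) a * w (g v e) <=
    \sum_(e in edges (g v H) | P e) w e.
  rewrite -gsum; apply: ler_sum => e /andP[eH _].
  apply: ler_piMl => //; apply: gw.
  exact: (fintype.subsetP (edgesS (finset.subsetT H))).
split; [apply: le_trans hr|apply: le_trans hb].
- apply: le_trans (aw (mem r)); apply/eq_leR/eq_bigl => e.
  by rewrite /= !inE.
- apply: le_trans (aw (fun e => e \notin r)); apply/eq_leR/eq_bigl => e.
  by rewrite /= !inE.
Qed.

Lemma wR_nondecreasing n k : (2 <= n)%N -> (k <= n)%N ->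
  wR R n k <= wR R n.+1 k.
Proof.
move=> n2 kn; apply: lb_le_inf; first by exists 'C(k, 2)%:R; exact: admissible_bin.
move=> q /= /(admissible_pred n2) qn; apply: ge_inf => //.
exact: admissible_lbound.
Qed.

Lemma wR_cvg k : (2 <= k)%N -> cvgn (fun n => wR R n k).
Proof.
move=> k2; apply: (@near_nondecreasing_is_cvgn _ _ 'C(k, 2)%:R).
  near=> n0 => m n0m.
  have [n2 kn] : (2 <= n0)%N /\ (k <= n0)%N.
    by split; near: n0; exact: nbhs_infty_ge.
  elim: m n0m => [|m IH]; first by rewrite leqn0 => /eqP ->.
  rewrite leq_eqVlt => /predU1P[->//|]; rewrite ltnS => n0m.
  apply: le_trans (IH n0m) _.
  by apply: wR_nondecreasing; [exact: leq_trans n2 _|exact: leq_trans kn _].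
near=> n; apply: ge_inf; last exact: admissible_bin.
by apply: admissible_lbound; near: n; exact: nbhs_infty_ge.
Unshelve. all: by end_near.
Qed.

Let admissible_for n k (red : {set {set 'I_n}}) q :=
  exists w : {set 'I_n} -> R,
    [/\ forall e, e \in edges [set: 'I_n]%SET -> 0 <= w e,
        \sum_(e in edges [set: 'I_n]%SET) w e = 'C(n, 2)%:R &
        forall H : {set 'I_n}, #|H| = k ->
          \sum_(e in edges H | e \in red) w e <= q /\
          \sum_(e in edges H | e \notin red) w e <= q].

Let admissible_for_min n k red q : (k <= n)%N -> admissible_for k red q ->
  exists2 q0, admissible_for k red q0 &
    forall q', @admissible_for n k red q' -> q0 <= q'.
Proof.
move=> kn; pose I := option {set 'I_n}.
pose X := prod_topology (fun _ : I => R : topologicalType).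
pose C : R := 'C(n, 2)%:R.
pose total : X -> R := fun f => \sum_(e in edges [set: 'I_n]%SET) f (Some e).
pose part (P : pred {set 'I_n}) (H : {set 'I_n}) : X -> R :=
  fun f => \sum_(e in edges H | P e) f (Some e).
pose red' : bool -> pred {set 'I_n} := fun b e => (e \in red) == b.
pose box : set X := [set f | forall i, `[0, C]%classic (f i)].
pose K : set X := box `&` (total @^-1` [set C] `&`
  \bigcap_(Hb in [set Hb : {set 'I_n} * bool | #|Hb.1| = k])
    [set f | part (red' Hb.2) Hb.1 f - f None <= 0]).
have cproj (i : I) : continuous (fun f : X => f i).
  exact: (@proj_continuous I (fun=> R : topologicalType) i).
have csum (r : pred {set 'I_n}) : continuous (fun f : X => \sum_(e | r e) f (Some e)).
  by apply: continuous_big => [|e _ f]; [exact: add_continuous|exact: cproj].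
have cK : compact K.
  apply: compact_closedI.
    apply: (@tychonoff I (fun=> R : topologicalType) (fun=> `[0, C]%classic)).
    by move=> _; exact: segment_compact.
  apply: closedI.
    by apply: preimage_closed; [move=> f _; exact: csum|exact: closed_eq].
  apply: closed_bigI => Hb _.
  rewrite (_ : [set _ | _] = (fun f => part (red' Hb.2) Hb.1 f - f None) @^-1`
    [set x | x <= 0])//.
  apply: preimage_closed; last exact: closed_le.
  move=> f _; apply: continuousB; [exact: csum|exact: cproj].
have KP f : K f -> admissible_for k red (f None).
  move=> [fb [ft fH]]; exists (fun e => f (Some e)); split=> //.
    by move=> e _; have := fb (Some e); rewrite /= in_itv/= => /andP[].
  move=> H Hk; split.
    have := fH (H, true) Hk; rewrite /= subr_le0; apply: le_trans.
    by apply/eq_leR/eq_bigl => e; rewrite /red' eqb_id.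
  have := fH (H, false) Hk; rewrite /= subr_le0; apply: le_trans.
  by apply/eq_leR/eq_bigl => e; rewrite /red' eqbF_neg.
have PK q1 : admissible_for k red q1 -> exists2 f, K f & f None <= q1.
  move=> [w [w0 ws h]].
  have q10 : 0 <= q1.
    by apply: (@admissible_ge0 n k) => //; exists w, red; split.
  pose f : X := fun i => if i is Some e then
    (if e \in edges [set: 'I_n]%SET then w e else 0) else Num.min q1 C.
  have fw H P : part P H f = \sum_(e in edges H | P e) w e.
    apply: eq_bigr => e /andP[eH _] /=.
    by rewrite (fintype.subsetP (edgesS (finset.subsetT H)) e eH).
  have ft : total f = C by rewrite /C -ws; apply: eq_bigr => e /= ->.
  exists f; last by rewrite /f ge_min lexx.
  split; [|split => //].
    move=> [e|] /=; rewrite in_itv /=; last first.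
      by rewrite le_min q10 ler0n ge_min lexx orbT.
    case: ifPn => [eE|_]; last by rewrite lexx ler0n.
    rewrite w0//= /C -ws (bigD1 e)//= ler_wpDr//.
    by apply: sumr_ge0 => e' /andP[/w0].
  move=> [H b] /= Hk; rewrite fw subr_le0 le_min; apply/andP; split; last first.
    by rewrite /C -ws; exact: edge_sum_le.
  have [h1 h2] := h H Hk; case: b; [apply: le_trans h1|apply: le_trans h2];
    apply/eq_leR/eq_bigl => e; by rewrite /red' ?eqb_id ?eqbF_neg.
move=> /PK[f0 Kf0 _].
have K0 : K !=set0 by exists f0.
have cN : {within K, continuous (fun f : X => f None)}.
  by apply: continuous_subspaceT; exact: cproj.
have [f Kf fmin] := compact_EVT_min K0 cK cN.
exists (f None); first by apply: KP; rewrite inE in Kf.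
move=> q' /PK[f' Kf' f'q']; apply: le_trans f'q'.
by apply: fmin; rewrite inE.
Qed.

Lemma wR_min n k : (k <= n)%N ->
  admissible n k (wR R n k) /\ forall q, admissible n k q -> wR R n k <= q.
Proof.
move=> kn; pose P red := `[< exists q, @admissible_for n k red q >].
have [m mP] : {m : {set {set 'I_n}} -> R & forall red, P red ->
    admissible_for k red (m red) /\
    forall q', admissible_for k red q' -> m red <= q'}.
  apply: (@choice _ _ (fun red q => P red -> admissible_for k red q /\
    forall q', admissible_for k red q' -> q <= q')) => red.
  have [/asboolP[q /(admissible_for_min kn)[q0 ? ?]]|nP] := boolP (P red).
    by exists q0.
  by exists 0 => Pr; case/negP: nP.
have [w0 [red0 adm0]] := admissible_bin n k.
have Pred0 : P red0 by apply/asboolP; exists 'C(k, 2)%:R, w0.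
case: (Order.TotalTheory.arg_minP m Pred0) => red Pred mred.
have [[w wP] _] := mP _ Pred.
have adm : admissible n k (m red) by exists w, red.
have lb q : admissible n k q -> m red <= q.
  move=> [w' [red' w'P]]; have Pr' : P red' by apply/asboolP; exists q, w'.
  by apply: le_trans (mred _ Pr') _; apply: (mP _ Pr').2; exists w'.
suff -> : wR R n k = m red by [].
apply/eqP; rewrite eq_le; apply/andP; split.
  by apply: ge_inf => //; exact: admissible_lbound.
by apply: lb_le_inf; [exists (m red)|exact: lb].
Qed.

End WellDefined.

(* Main.v *)
Require Import Defs.
From mathcomp Require Import all_boot all_order all_algebra.
From mathcomp Require Import reals.
From mathcomp Require Import ring lra zify.

(* Write F = floor(k^2/4).

   Lower bound W(k) >= 1.06 F for all k >= 4. Suppose that each colour has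
   weight at most q < 1.06 F on every k-set, n being large. The 15 edges of a
   random 6-tuple of vertices have average total weight 15 - o(1), so a positive
   proportion of the 6-tuples have weight at least 14.98. By Erdos' theorem on
   complete multipartite hypergraphs and the pigeonhole principle there are six
   disjoint k-sets S_1, ..., S_6 such that between S_i and S_j all edges have
   one colour and weight beta_ij up to 1/1000, and all transversals have weight
   at least 14.98. A k-set inside S_i u S_j gives beta_ij <= M := 1.06; a k-set
   of parts x, y, z with x + y = ceil(k/2) and z = floor(k/2) inside a
   monochromatic S_i u S_j u S_l gives
   beta_il + beta_jl + (4/9) beta_ij <= 2 M. Every 2-colouring of K_6 has two
   monochromatic triangles, which share at most one edge; in each case these
   inequalities force a total loss of (8/9) M, so that the beta_ij add up to at
   most (15 - 8/9) M < 14.96, a contradiction.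

   Upper bounds: the blow-up of the 5-cycle and its complement, with weight
   about 5/4 across the parts and 0 inside, gives 1.25 F by Mantel's theorem.
   For k = 4, two equal parts with red edges of weight 4/5 inside and blue edges
   of weight about 6/5 across give 4.8. *)

Set Implicit Arguments.
Unset Strict Implicit.
Unset Printing Implicit Defensive.

Import Order.TTheory GRing.Theory Num.Theory.
Local Open Scope ring_scope.

(** * Monochromatic triangles in K_6 *)

(* The 15 edges of K_6 are numbered so that [{i, j}] with [i < j] gets the
   colexicographic rank C(j, 2) + i. *)
Definition edge_rank (i j : nat) : nat :=
  if (i < j)%N then ('C(j, 2) + i)%N else ('C(i, 2) + j)%N.

Definition triangles6 : seq (nat * nat * nat) :=
  [seq t <- [seq (p, l) | p <- [seq (i, j) | i <- iota 0 6, j <- iota 0 6],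
                          l <- iota 0 6]
  | (t.1.1 < t.1.2 < t.2)%N].

Definition triangle_edges (t : nat * nat * nat) : seq nat :=
  [:: edge_rank t.1.1 t.1.2; edge_rank t.1.1 t.2; edge_rank t.1.2 t.2].

Definition mono (s : bitseq) (t : seq nat) : bool :=
  constant [seq nth false s e | e <- t].

(** A quantifier over bit sequences that reduces by evaluation, so that a claim about all colourings
    of K_6 becomes a finite computation. *)
Fixpoint all_bits (n : nat) (P : pred bitseq) : bool :=
  if n is n'.+1 then
    all_bits n' (fun s => P (true :: s)) && all_bits n' (fun s => P (false :: s))
  else P [::].

Lemma all_bitsP n P : all_bits n P -> forall s, size s = n -> P s.
Proof.
elim: n P => [|n IH] P /=; first by move=> Pn [|].
by case/andP => /IH Pt /IH Pf [|[] s]//= [sn]; [exact: Pt|exact: Pf].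
Qed.

Lemma two_mono_triangles (s : bitseq) : size s = 15%N ->
  (1 < count (mono s) [seq triangle_edges t | t <- triangles6])%N.
Proof.
move: s; apply: all_bitsP.
pose ts := [seq triangle_edges t | t <- triangles6].
have -> : [seq triangle_edges t | t <- triangles6] = ts by [].
(* Normalised first, lest it be recomputed for each of the 2^15 colourings. *)
have Ets : ts = ltac:(let x := eval vm_compute in ts in exact x) by vm_compute.
by rewrite Ets; vm_compute.
Qed.

Lemma count_gt1 (T : eqType) (P : pred T) (s : seq T) : uniq s ->
  (1 < count P s)%N ->
  exists x y, [/\ x \in s, y \in s, x != y, P x & P y].
Proof.
rewrite -size_filter => /(filter_uniq P); case E: (filter P s) => [|x [|y s']]//=.
rewrite inE negb_or => /andP[/andP[xy _] _] _; exists x, y.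
have : x \in filter P s by rewrite E inE eqxx.
have : y \in filter P s by rewrite E !inE eqxx orbT.
by rewrite !mem_filter => /andP[-> ->] /andP[-> ->].
Qed.

Definition edge_disjoint (s t : seq nat) : bool := uniq (s ++ t).

(** The rotations bring the common edge to the front of both lists; [uniq] then says that the two
    triangles have five distinct edges together. *)
Definition share_edge (s t : seq nat) : bool :=
  has (fun a => has (fun b =>
    (head 0%N (rot a s) == head 0%N (rot b t)) &&
    uniq (rot a s ++ behead (rot b t))) (iota 0 3)) (iota 0 3).

Lemma triangle_pairs (s t : seq nat) :
  s \in [seq triangle_edges t | t <- triangles6] ->
  t \in [seq triangle_edges t | t <- triangles6] ->
  s != t -> edge_disjoint s t || share_edge s t.
Proof.
have : all (fun s => all (fun t => (s != t) ==> (edge_disjoint s t || share_edge s t))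
    [seq triangle_edges t | t <- triangles6])
    [seq triangle_edges t | t <- triangles6] by vm_compute.
by move=> /allP/(_ s)/[apply]/allP/(_ t)/[apply]/implyP.
Qed.

Lemma ler_sum_subset (R : numDomainType) (T : eqType) (d : T -> R) (s r : seq T) :
  uniq s -> {subset s <= r} -> uniq r -> (forall e, e \in r -> 0 <= d e) ->
  \sum_(e <- s) d e <= \sum_(e <- r) d e.
Proof.
move=> us sr ur d0.
have E : \sum_(e <- r | e \in s) d e = \sum_(e <- s) d e.
  rewrite -big_filter; apply/perm_big/uniq_perm => [||e] //.
    by rewrite filter_uniq.
  by rewrite mem_filter; apply/andP/idP => [[]|es] //; split=> //; exact: sr.
rewrite [leRHS](bigID (mem s)) /= E lerDl big_seq_cond.
by apply: sumr_ge0 => e /andP[/d0].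
Qed.

(** Here [d e] stands for the loss M - beta_e. Each of two monochromatic triangles loses (4/9) M. If
    they are edge-disjoint, their inequalities simply add up. If they share an edge, both are
    rotated so that this edge has coefficient 4/9; in the sum it then has coefficient 8/9, which is
    still at most 1. *)
Lemma K6_defect (R : realFieldType) (d : nat -> R) (c : nat -> bool) (M : R) :
  (forall e, (e < 15)%N -> 0 <= d e) ->
  (forall t a, t \in triangles6 -> mono (mkseq c 15) (triangle_edges t) ->
     let e := nth 0%N (rot a (triangle_edges t)) in
     4 / 9 * M <= d (e 1%N) + d (e 2%N) + 4 / 9 * d (e 0%N)) ->
  8 / 9 * M <= \sum_(e <- iota 0 15) d e.
Proof.
move=> d0 dt.
have le15 s : uniq s -> {subset s <= iota 0 15} ->
    \sum_(e <- s) d e <= \sum_(e <- iota 0 15) d e.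
  move=> us ss; apply: ler_sum_subset => //.
  by move=> e; rewrite mem_iota => /d0.
have sub15 t : t \in triangles6 -> {subset triangle_edges t <= iota 0 15}.
  move=> tT; apply/allP; move: t tT; apply/allP.
  by vm_compute.
have us : uniq [seq triangle_edges t | t <- triangles6] by vm_compute.
have [] := count_gt1 us (two_mono_triangles (size_mkseq c 15)).
move=> s [t [sT tT st ms mt]].
have := triangle_pairs sT tT st; move: sT tT ms mt {st} => /mapP[s' s'T ->].
move=> /mapP[t' t'T ->] ms mt.
have hs a := dt _ a s'T ms; have ht a := dt _ a t'T mt.
have ss := sub15 _ s'T; have st := sub15 _ t'T.
case/orP => [u|/hasP[a _ /hasP[b _ /andP[/eqP ab u]]]].
  have /le15 : {subset triangle_edges s' ++ triangle_edges t' <= iota 0 15}.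
    by move=> e; rewrite mem_cat => /orP[/ss|/st].
  move=> /(_ u); rewrite big_cat !big_cons !big_nil /=.
  have dn t0 e : {subset triangle_edges t0 <= iota 0 15} ->
      e \in triangle_edges t0 -> 0 <= d e.
    by move=> /[apply]; rewrite mem_iota => /d0.
  have := dn _ _ ss (mem_head _ _); have := dn _ _ st (mem_head _ _).
  move: (hs 0%N) (ht 0%N); rewrite /= !addr0; lra.
have /le15 : {subset rot a (triangle_edges s') ++
    behead (rot b (triangle_edges t')) <= iota 0 15}.
  move=> e; rewrite mem_cat mem_rot => /orP[/ss//|/mem_behead].
  by rewrite mem_rot => /st.
move=> /(_ u); rewrite big_cat /=.
have Er n' t0 : size (rot n' (triangle_edges t0)) = 3%N by rewrite size_rot.
have := d0 (head 0%N (rot a (triangle_edges s'))).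
have /[swap]/[apply] : (head 0%N (rot a (triangle_edges s')) < 15)%N.
  have /ss : head 0%N (rot a (triangle_edges s')) \in triangle_edges s'.
    by rewrite -(mem_rot a) -nth0 mem_nth// size_rot.
  by rewrite mem_iota.
move: ab (hs a) (ht b) (Er a s') (Er b t').
case: (rot a _) => [|e1 [|e2 [|e3 []]]]//; case: (rot b _) => [|f1 [|f2 [|f3 []]]]//.
move=> /= -> hs' ht' _ _ df; rewrite !big_cons !big_nil !addr0.
by move: hs' ht' df; lra.
Qed.

Definition rank_ends (e : nat) : nat * nat :=
  nth (0, 0)%N [seq p <- [seq (i, j) | j <- iota 0 6, i <- iota 0 6] | (p.1 < p.2)%N] e.

Lemma edge_rankK (i j : nat) : (i < j < 6)%N ->
  (edge_rank i j < 15)%N /\ rank_ends (edge_rank i j) = (i, j).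
Proof.
have : all (fun i => all (fun j => (i < j)%N ==>
    (edge_rank i j < 15)%N && (rank_ends (edge_rank i j) == (i, j)))
    (iota 0 6)) (iota 0 6).
  by vm_compute.
move=> /allP/(_ i) + /andP[ij j6]; rewrite !mem_iota (ltn_trans ij j6).
by move=> /(_ isT)/allP/(_ j); rewrite mem_iota j6 ij => /(_ isT)/andP[-> /eqP].
Qed.

Lemma K6_weight (R : realFieldType) (beta : nat -> nat -> R) (col : nat -> nat -> bool)
    (M : R) :
  (forall i j, (i < j < 6)%N -> beta i j <= M) ->
  (forall i j, beta i j = beta j i) ->
  (forall i j, col i j = col j i) ->
  (forall i j l, (i < 6)%N -> (j < 6)%N -> (l < 6)%N -> uniq [:: i; j; l] ->
     col i j = col i l -> col i j = col j l ->
     beta i l + beta j l + 4 / 9 * beta i j <= 2 * M) ->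
  \sum_(e <- iota 0 15) beta (rank_ends e).1 (rank_ends e).2 <= 127 / 9 * M.
Proof.
move=> leM sym csym tri.
have := @K6_defect R (fun e => M - beta (rank_ends e).1 (rank_ends e).2)
  (fun e => col (rank_ends e).1 (rank_ends e).2) M.
rewrite sumrB big_const_seq count_predT size_iota iter_addr_0.
move=> H; suff : 8 / 9 * M <= M *+ 15 -
    \sum_(e <- iota 0 15) beta (rank_ends e).1 (rank_ends e).2 by lra.
apply: H => [e e15|[[i j] l] a].
  rewrite subr_ge0; apply: leM.
  have /allP/(_ e) :
      all (fun e => ((rank_ends e).1 < (rank_ends e).2 < 6)%N) (iota 0 15).
    by vm_compute.
  by rewrite mem_iota; apply.
move=> tT; have [ij jl l6] : [/\ (i < j)%N, (j < l)%N & (l < 6)%N].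
  apply/and3P; have /allP/(_ _ tT) // : all (fun t =>
    [&& t.1.1 < t.1.2, t.1.2 < t.2 & t.2 < 6]%N) triangles6 by vm_compute.
have [rij eij] : (edge_rank i j < 15)%N /\ rank_ends (edge_rank i j) = (i, j).
  by apply: edge_rankK; lia.
have [ril eil] : (edge_rank i l < 15)%N /\ rank_ends (edge_rank i l) = (i, l).
  by apply: edge_rankK; lia.
have [rjl ejl] : (edge_rank j l < 15)%N /\ rank_ends (edge_rank j l) = (j, l).
  by apply: edge_rankK; lia.
set c := mkseq _ 15; have cE e : (e < 15)%N ->
    nth false c e = col (rank_ends e).1 (rank_ends e).2 by exact: nth_mkseq.
rewrite /mono /= !cE// eij eil ejl /= => /and3P[/eqP cil /eqP cjl _].
have := tri i j l; have := tri i l j; have := tri j l i.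
rewrite (csym l j) (csym j i) (csym l i) (sym l j) (sym j i) (sym l i) /= !inE.
have -> : (i == j) = false by lia.
have -> : (i == l) = false by lia.
have -> : (j == l) = false by lia.
have -> : (l == j) = false by lia.
have -> : (l == i) = false by lia.
have -> : (j == i) = false by lia.
have -> : (i < 6)%N by lia.
have -> : (j < 6)%N by lia.
have -> : (l < 6)%N by lia.
rewrite cil cjl => /(_ isT isT isT isT erefl erefl) h1.
move=> /(_ isT isT isT isT erefl erefl) h2 /(_ isT isT isT isT erefl erefl) h3.
(* The rotation chooses which edge gets the coefficient 4/9, hence the three instances of [tri];
   rotating by 3 or more changes nothing. *)
case: a => [|[|[|a]]] /=; rewrite ?eij ?eil ?ejl /=; lra.
Qed.

(** * Complete multipartite blow-ups in dense sets of tuples *)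

Local Open Scope nat_scope.

Lemma ffact_le_exp n t : (n ^_ t <= n ^ t)%N.
Proof.
elim: t n => [|t IH] n; first by rewrite ffactn0.
rewrite ffactnS expnS leq_mul2l; apply/orP; right.
by apply: leq_trans (IH _) _; case: (t) => // t'; rewrite leq_exp2r// leq_pred.
Qed.

Lemma exp_le_ffact n t : ((n - t) ^ t <= n ^_ t)%N.
Proof.
elim: t n => [|t IH] n; first by rewrite ffactn0.
rewrite ffactnS expnS leq_mul ?leq_subr//.
by rewrite (_ : n - t.+1 = n.-1 - t)%N; [exact: IH|lia].
Qed.

(** The hypotheses give d >= 2t, so d - t >= d/2 and n <= 4D(d - t). Falling factorials are then
    compared with t-th powers. *)
Lemma bin_ratio D n d t : (4 * D * t <= n)%N -> (n <= 2 * D * d)%N -> (0 < D)%N ->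
  ('C(n, t) <= (4 * D) ^ t * 'C(d, t))%N.
Proof.
move=> nt nd D0; rewrite -(leq_pmul2r (fact_gt0 t)) -mulnA !bin_ffact.
apply: leq_trans (ffact_le_exp n t) _.
apply: leq_trans (leq_mul (leqnn _) (exp_le_ffact d t)); rewrite -expnMn.
have : (2 * t <= d)%N by rewrite -(@leq_pmul2l (2 * D)); nia.
case: t {nt} => // t td; rewrite leq_exp2r//; nia.
Qed.

Lemma sum_tupleS (T : finType) (V : nmodType) (r : nat) (F : r.+1.-tuple T -> V) :
  (\sum_x F x = \sum_u \sum_(y : r.-tuple T) F [tuple of u :: y])%R.
Proof.
rewrite pair_bigA /=; apply/esym.
rewrite (reindex (fun x : r.+1.-tuple T => (thead x, [tuple of behead x])))/=.
  by apply: eq_bigr => x _; rewrite [in RHS](tuple_eta x).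
exists (fun p : T * r.-tuple T => [tuple of p.1 :: p.2]) => [x _|[u y] _] /=.
  by rewrite [RHS]tuple_eta.
by rewrite theadE; congr pair; apply: val_inj.
Qed.

(* The Kovari-Sos-Turan step: most [y] have a large [A]-neighbourhood, and a
   [t]-subset lying in the neighbourhoods of many [y] exists by averaging. *)
Lemma common_neighbourhood (T Y : finType) (A : {set T * Y}) (D t : nat) :
  (0 < D)%N -> (4 * D * t <= #|T|)%N -> (t <= #|T|)%N ->
  (#|T| * #|Y| <= D * #|A|)%N ->
  exists2 S : {set T}, #|S| = t &
    (#|Y| <= 2 * D * (4 * D) ^ t * #|[set y | [forall u in S, (u, y) \in A]]|)%N.
Proof.
move=> D0 Tt tT AD; set n := #|T|.
pose nb y := [set u | (u, y) \in A]%SET.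
pose Y' := [set y | n <= 2 * D * #|nb y|]%N%SET.
have cA : (#|A| = \sum_y #|nb y|)%N.
  rewrite -sum1_card big_mkcond /=.
  rewrite (eq_bigr
    (fun p => (fun u y => if (u, y) \in A then 1 else 0)%N p.1 p.2)); last first.
    by case.
  rewrite -(pair_bigA _ (fun u y => if (u, y) \in A then 1 else 0)%N) exchange_big /=.
  by apply: eq_bigr => y _; rewrite -big_mkcond /= sum1dep_card.
(* Each y outside [Y'] has fewer than n/(2D) neighbours, so these y account for at most half of the
   n|Y|/D pairs that [A] must contain. *)
have Y'_large : (#|Y| <= 2 * D * #|Y'|)%N.
  have [n0|n0] := posnP n.
    rewrite (_ : Y' = setT) ?cardsT; first by nia.
    by apply/setP => y; rewrite !inE n0.
  have : (2 * D * #|A| <= 2 * D * n * #|Y'| + n * #|Y|)%N.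
    rewrite cA big_distrr /= (bigID (mem Y')) /=; apply: leq_add.
      rewrite (mulnC _ #|Y'|) -sum_nat_const; apply: leq_sum => y _.
      by rewrite leq_mul2l /n max_card orbT.
    apply: (@leq_trans (\sum_(y in ~: Y') n)%N); last first.
      by rewrite sum_nat_const mulnC leq_mul2l max_card orbT.
    rewrite (eq_bigl (mem (~: Y')%SET)) => [|y]; last by rewrite !inE.
    by apply: leq_sum => y; rewrite !inE -ltnNge => /ltnW.
  by move: AD; rewrite -/n => AD h; rewrite -(leq_pmul2l n0); nia.
pose Z (S : {set T}) := [set y | [forall u in S, (u, y) \in A]]%SET.
pose Ts := [set S : {set T} | #|S| == t].
have cTs : #|Ts| = 'C(n, t) by rewrite card_draws.
have Ts0 : (0 < #|Ts|)%N by rewrite cTs bin_gt0.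
(* Double counting of the pairs (S, y) with S a [t]-subset of the neighbourhood of y. *)
have dc : (\sum_(S in Ts) #|Z S| = \sum_y 'C(#|nb y|, t))%N.
  under eq_bigr do rewrite -sum1_card big_mkcond /=.
  rewrite exchange_big /=; apply: eq_bigr => y _.
  rewrite -big_mkcondr /= sum1dep_card -cards_draws.
  apply: eq_card => S; rewrite !inE andbC; congr (_ && _).
  apply/forall_inP/subsetP => h u uS; last by have := h u uS; rewrite inE.
  by rewrite inE; exact: h.
have dcY : (#|Y'| * #|Ts| <= (4 * D) ^ t * \sum_(S in Ts) #|Z S|)%N.
  rewrite dc cTs big_distrr /= -sum_nat_const [leqRHS](bigID (mem Y')) /=.
  apply: leq_trans (leq_addr _ _); apply: leq_sum => y; rewrite inE => yY.
  exact: bin_ratio.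
have [S ST SZ] : exists2 S, S \in Ts & (#|Y'| <= (4 * D) ^ t * #|Z S|)%N.
  apply/exists_inP; apply: contraLR dcY; rewrite negb_exists_in => /forall_inP h.
  rewrite -ltnNge big_distrr /= (mulnC #|Y'|) -sum_nat_const.
  have [S0 S0T] := card_gt0P Ts0.
  rewrite (bigD1 S0)//= [ltnRHS](bigD1 S0)//= -addSn leq_add//.
    by rewrite ltnNge; exact: h.
  by apply: leq_sum => S /andP[ST _]; rewrite ltnW// ltnNge; exact: h.
exists S; first by move: ST; rewrite inE => /eqP.
by apply: leq_trans Y'_large _; rewrite -[leqRHS]mulnA leq_mul2l SZ orbT.
Qed.

(** Induction on [r], splitting a tuple into head and tail: [common_neighbourhood] finds [t] heads
    that share a set of tails of density at least 1/(2D(4D)^t), and the induction hypothesis applies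
    to these tails. The sets found here may overlap. *)
Lemma blowup (r D t : nat) : (0 < D)%N -> exists N, forall n (A : {set r.-tuple 'I_n}),
  (N <= n)%N -> (n ^ r <= D * #|A|)%N ->
  exists2 S : nat -> {set 'I_n}, forall i, #|S i| = t &
    forall x : r.-tuple 'I_n, (forall i : 'I_r, tnth x i \in S i) -> x \in A.
Proof.
elim: r D => [|r IH] D D0.
  exists t => n A tn; rewrite expn0 => A0.
  have : (0 < #|[set S : {set 'I_n} | #|S| == t]|)%N.
    by rewrite card_draws card_ord bin_gt0.
  case/card_gt0P => S; rewrite inE => /eqP St; exists (fun=> S) => // x _.
  have /card_gt0P[y yA] : (0 < #|A|)%N by nia.
  by rewrite (tuple0 x) -(tuple0 y).
have D'0 : (0 < 2 * D * (4 * D) ^ t)%N by rewrite !muln_gt0 expn_gt0 muln_gt0 D0.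
have [N HN] := IH _ D'0.
exists (maxn N (maxn t (4 * D * t))) => n A; rewrite !geq_max => /and3P[Nn tn Dn] An.
pose A' := [set p : 'I_n * r.-tuple 'I_n | [tuple of p.1 :: p.2] \in A]%SET.
have cA : #|A'| = #|A|.
  rewrite -!sum1_card [RHS]big_mkcond sum_tupleS pair_bigA [LHS]big_mkcond /=.
  by apply: eq_bigr => -[u y] _; rewrite inE.
have [||| S0 S0t] := @common_neighbourhood 'I_n (r.-tuple 'I_n) A' D t D0;
  rewrite ?card_ord//.
  by rewrite card_tuple card_ord cA -expnS.
rewrite card_tuple card_ord => /(HN _ _ Nn)[S St SA].
exists (fun i => if i is i'.+1 then S i' else S0); first by case.
move=> x xS; rewrite (tuple_eta x).
have /SA : forall i : 'I_r, tnth [tuple of behead x] i \in S i.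
  by move=> i; have := xS (lift ord0 i); rewrite [in X in X -> _](tuple_eta x) tnthS.
rewrite inE => /forall_inP/(_ (thead x)); rewrite inE; apply.
exact: (xS ord0).
Qed.

Local Open Scope ring_scope.

(** Pigeonhole on the pattern of pairwise colours of a tuple: one pattern class is still dense, and
    [blowup] is applied to it. The successor in |KK| + 1 keeps the constant positive and makes the
    averaging inequality strict. *)
Lemma homogeneous_blowup (K : finType) (r D t : nat) : (0 < D)%N -> (0 < t)%N ->
  exists N, forall n (c : 'I_n -> 'I_n -> K) (A : {set r.-tuple 'I_n}),
  (N <= n)%N -> (n ^ r <= D * #|A|)%N ->
  exists (S : nat -> {set 'I_n}) (kappa : 'I_r -> 'I_r -> K),
    [/\ forall i, #|S i| = t,
        forall i j : 'I_r, i != j -> {in S i & S j, forall u v, c u v = kappa i j} &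
        forall x : r.-tuple 'I_n, (forall i : 'I_r, tnth x i \in S i) -> x \in A].
Proof.
move=> D0 t0; pose KK := {ffun 'I_r * 'I_r -> K}.
have [|N HN] := @blowup r (D * #|KK|.+1) t; first by rewrite muln_gt0 D0.
exists (maxn N 1) => n c A; rewrite geq_max => /andP[Nn n0] An.
pose tau (x : r.-tuple 'I_n) : KK := [ffun p => c (tnth x p.1) (tnth x p.2)].
pose Ak ka := [set x in A | tau x == ka].
have cA : (#|A| = \sum_ka #|Ak ka|)%N.
  rewrite -sum1_card (partition_big tau xpredT)//=; apply: eq_bigr => ka _.
  by rewrite -sum1_card; apply: eq_bigl => x; rewrite inE.
have [ka hka] : exists ka, (n ^ r <= D * #|KK|.+1 * #|Ak ka|)%N.
  apply/existsP; have nr0 : (0 < n ^ r)%N by rewrite expn_gt0 n0.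
  have : ~~ (D * #|KK|.+1 * #|A| <= #|KK| * n ^ r)%N by rewrite -ltnNge; nia.
  apply: contraR; rewrite negb_exists => /forallP h.
  rewrite cA big_distrr /= -sum_nat_const.
  by apply: leq_sum => ka _; rewrite ltnW// ltnNge; exact: h.
have [S St SA] := HN _ _ Nn hka.
exists S, (fun i j => ka (i, j)); split=> // [i j ij u v uS vS|x /SA]; last first.
  by rewrite inE => /andP[].
have y_ex l : exists y, y \in S l by apply/card_gt0P; rewrite St.
(* The transversal with u in place i, v in place j and arbitrary other entries has pattern [ka],
   which determines [c u v]. *)
pose x := [tuple
  (if l == i then u else if l == j then v else xchoose (y_ex l)) | l < r].
have /SA : forall l : 'I_r, tnth x l \in S l.
  move=> l; rewrite tnth_mktuple; case: eqP => [->//|_].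
  by case: eqP => [->//|_]; exact: xchooseP.
rewrite inE => /andP[_ /eqP <-]; rewrite ffunE /= !tnth_mktuple eqxx.
by rewrite eq_sym (negbTE ij) eqxx.
Qed.

(** * Averaging pair weights over tuples *)

Section PairSum.
Variables (R : realFieldType) (T : finType) (f : T -> T -> R).

Fixpoint pair_sum (s : seq T) : R :=
  if s is u :: s' then \sum_(v <- s') f u v + pair_sum s' else 0.

Lemma pair_sum_le (B : R) (s : seq T) : (forall u v, f u v <= B) ->
  pair_sum s <= 'C(size s, 2)%:R * B.
Proof.
move=> fB; elim: s => [|u s IH] /=; first by rewrite bin0n mul0r.
rewrite binS bin1 natrD mulrDl addrC lerD//.
elim: s {IH} => [|v s IH]; rewrite ?big_nil ?mul0r// big_cons /=.
by rewrite -natr1 mulrDl mul1r addrC lerD.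
Qed.

Lemma sum_tuple_linear (g : T -> R) (r : nat) :
  \sum_(x : r.-tuple T) \sum_(v <- x) g v =
  r%:R * #|T|%:R ^+ r.-1 * \sum_v g v.
Proof.
elim: r => [|r IH].
  rewrite !mul0r big1// => x _; by rewrite tuple0 big_nil.
rewrite sum_tupleS; under eq_bigr do under eq_bigr do rewrite big_cons.
under eq_bigr do rewrite big_split /= IH sumr_const card_tuple.
rewrite big_split /= sumr_const sumrMnl -[_ *+ (_ ^ _)]mulr_natl natrX.
rewrite -[_ *+ #|T|]mulr_natl -natr1.
by case: r {IH} => [|r] /=; rewrite ?exprS; ring.
Qed.

(** Each of the C(r, 2) pairs of positions takes every value (u, v), the diagonal included, in
    |T|^(r - 2) tuples. For r < 2 the truncated exponent is harmless, as the binomial vanishes. *)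
Lemma sum_tuple_pair_sum (r : nat) :
  \sum_(x : r.-tuple T) pair_sum x =
  'C(r, 2)%:R * #|T|%:R ^+ (r - 2) * \sum_u \sum_v f u v.
Proof.
elim: r => [|r IH].
  rewrite !mul0r big1// => x _; by rewrite tuple0.
rewrite sum_tupleS; under eq_bigr do rewrite big_split /= IH sum_tuple_linear.
have sum_cst (a : R) : \sum_(u : T) a = #|T|%:R * a by rewrite sumr_const mulr_natl.
rewrite big_split /= -mulr_sumr sum_cst binS bin1 natrD.
case: r {IH} => [|[|r]]; first by rewrite bin0n /=; ring.
  rewrite (_ : 'C(1, 2) = 0%N)// (_ : (1 - 2)%N = 0%N)// (_ : (2 - 2)%N = 0%N)//=.
  by ring.
rewrite (_ : (r.+3 - 2)%N = r.+1); last by lia.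
rewrite (_ : (r.+2 - 2)%N = r); last by lia.
rewrite /= exprS; ring.
Qed.

(** Put n = |T|. The total over all tuples is 15 n^6 - 15 n^5, and n >= 1500 gives 15 n^5 <= 0.01
    n^6. Tuples outside [A] contribute at most 14.98 n^6 and those in [A] at most 15 B each, so 15 B
    |A| >= 0.01 n^6. *)
Lemma dense_heavy_tuples (B : nat) :
  (1500 <= #|T|)%N -> (forall u v, f u v <= B%:R) ->
  \sum_u \sum_v f u v = #|T|%:R * (#|T|%:R - 1) ->
  (#|T| ^ 6 <= 1500 * B * #|[set x : 6.-tuple T | (1498 / 100 <= pair_sum x)%R]|)%N.
Proof.
move=> nT fB fsum; set A := [set x | _].
have tot := sum_tuple_pair_sum 6; rewrite fsum in tot.
have : \sum_(x : 6.-tuple T) pair_sum x <=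
    #|A|%:R * (15 * B%:R) + #|T|%:R ^+ 6 * (1498 / 100).
  rewrite (bigID (mem A)) /=; apply: lerD.
    rewrite [leRHS]mulr_natl -sumr_const; apply: ler_sum => x _.
    by apply: le_trans (pair_sum_le x fB) _; rewrite size_tuple.
  apply: (@le_trans _ _ (\sum_(x in ~: A) (1498 / 100))).
    rewrite (eq_bigl (mem (~: A))) => [|x]; last by rewrite !inE.
    by apply: ler_sum => x; rewrite !inE -ltNge => /ltW.
  have -> : \sum_(x in ~: A) (1498 / 100) = #|~: A|%:R * (1498 / 100) :> R.
    by rewrite sumr_const [RHS]mulr_natl.
  rewrite -natrX -card_tuple ler_wpM2r ?ler_nat ?max_card//.
  by rewrite divr_ge0 ?ler0n.
rewrite tot -(ler_nat R) natrX !natrM => h.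
have n1500 : 1500 <= #|T|%:R :> R by rewrite ler_nat.
have n5 : 0 <= #|T|%:R ^+ 5 :> R by rewrite exprn_ge0.
have := ler_wpM2r n5 n1500; rewrite -exprS.
move: h; rewrite (_ : 'C(6, 2) = 15)// (_ : (6 - 2)%N = 4%N)//.
rewrite (_ : 15 * _ ^+ 4 * _ = 15 * #|T|%:R ^+ 6 - 15 * #|T|%:R ^+ 5); last ring.
lra.
Qed.
End PairSum.

(** * Weights on blown-up configurations *)

Lemma sum_pairs_edges (V : nmodType) n (H : {set 'I_n}) (g : {set 'I_n} -> V) :
  \sum_(u in H) \sum_(v in H | v != u) g [set u; v]%SET =
  (\sum_(e in edges H) g e) *+ 2.
Proof.
rewrite pair_big_dep /=.
rewrite (partition_big (fun p => [set p.1; p.2]%SET) (mem (edges H))) /=; last first.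
  move=> [u v] /= /and3P[uH vH vu].
  by rewrite inE subUset !sub1set uH vH cards2 (eq_sym u) vu.
rewrite -sumrMnl; apply: eq_bigr => e; rewrite inE => /andP[eH /cards2P[a [b [ab E]]]].
have [aH bH] : a \in H /\ b \in H.
  by apply/andP; move: eH; rewrite E subUset !sub1set.
rewrite (eq_bigr (fun=> g e)) => [|p /andP[_ /eqP ->]//].
rewrite sumr_const; congr (_ *+ _).
rewrite (_ : 2 = #|[set (a, b); (b, a)]|)%N; last first.
  by rewrite cards2 xpair_eqE (negbTE ab).
apply: eq_card => -[u v]; rewrite !inE unfold_in /= E !xpair_eqE.
apply/idP/idP => [/andP[/and3P[_ _ vu] /eqP S]|].
  have : u \in [set a; b]%SET by rewrite -S !inE eqxx.
  have : v \in [set a; b]%SET by rewrite -S !inE eqxx orbT.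
  rewrite !inE => /orP[]/eqP hv /orP[]/eqP hu; move: vu; rewrite hu hv !eqxx //=.
  by rewrite orbT.
case/orP => /andP[/eqP -> /eqP ->]; first by rewrite aH bH eq_sym ab eqxx.
by rewrite aH bH ab finset.setUC eqxx.
Qed.

Lemma big_disjointU (V : nmodType) (T : finType) (A B : {set T}) (F : T -> V) :
  [disjoint A & B] -> \sum_(i in A :|: B) F i = \sum_(i in A) F i + \sum_(i in B) F i.
Proof. by move=> AB; rewrite -bigU//; apply: eq_bigl => i; rewrite !inE. Qed.

Section Parts.
Variables (R : realDomainType) (n k : nat) (q : R).
Variables (w : {set 'I_n} -> R) (P : pred {set 'I_n}).
Hypothesis w_ge0 : forall e, e \in edges [set: 'I_n] -> 0 <= w e.
Hypothesis w_le : forall H : {set 'I_n}, #|H| = k ->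
  \sum_(e in edges H | P e) w e <= q.

Lemma parts_bound (X Y Z : {set 'I_n}) (a b s : R) :
  [disjoint X & Y] -> [disjoint X & Z] -> [disjoint Y & Z] ->
  (#|X| + #|Y| + #|Z|)%N = k ->
  {in X & Y, forall u v, P [set u; v] /\ s <= w [set u; v]} ->
  {in X & Z, forall u v, P [set u; v] /\ a <= w [set u; v]} ->
  {in Y & Z, forall u v, P [set u; v] /\ b <= w [set u; v]} ->
  (#|X| * #|Y|)%:R * s + (#|X| * #|Z|)%:R * a + (#|Y| * #|Z|)%:R * b <= q.
Proof.
move=> XY XZ YZ card_k hs ha hb.
have XYZ : [disjoint X :|: Y & Z].
  by rewrite -setI_eq0 finset.setIUl setU_eq0 !setI_eq0 XZ.
set H := X :|: Y :|: Z.
have Hk : #|H| = k.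
  by rewrite -card_k /H !cardsU !disjoint_setI0// !cards0 !subn0.
apply: le_trans (w_le Hk).
pose g e := if P e then w e else 0.
pose h u v := if v != u then g [set u; v] else 0.
have edgeT u v : v != u -> [set u; v] \in edges [set: 'I_n].
  by move=> vu; rewrite inE finset.subsetT cards2 (eq_sym u) vu.
have h0 u v : 0 <= h u v.
  rewrite /h /g; case: ifP => // /edgeT /w_ge0; by case: ifP.
pose T (A B : {set 'I_n}) := \sum_(u in A) \sum_(v in B) h u v.
have T0 A B : 0 <= T A B by apply: sumr_ge0 => u _; apply: sumr_ge0.
have TC A B : T A B = T B A.
  rewrite /T exchange_big /=; apply: eq_bigr => u _; apply: eq_bigr => v _.
  by rewrite /h eq_sym finset.setUC.
have Tge (A B : {set 'I_n}) c : [disjoint A & B] ->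
    {in A & B, forall u v, P [set u; v] /\ c <= w [set u; v]} ->
    (#|A| * #|B|)%:R * c <= T A B.
  move=> AB hc; have -> : (#|A| * #|B|)%:R * c = \sum_(u in A) \sum_(v in B) c.
    by rewrite !sumr_const -mulrnA mulnC mulr_natl.
  apply: ler_sum => u uA; apply: ler_sum => v vB.
  have [Puv cw] := hc u v uA vB; rewrite /h /g Puv.
  by case: eqP vB => [->|//]; rewrite (disjointFr AB uA).
have -> : \sum_(e in edges H | P e) w e = \sum_(e in edges H) g e.
  by rewrite [LHS]big_mkcondr.
(* Doubling turns the edge sum into the sum over ordered pairs [T H H], which expands bilinearly
   over the three parts: each cross term appears twice, and the terms inside a part are
   nonnegative. *)
rewrite -(ler_pMn2r (n:=2))// -sum_pairs_edges.
have -> : \sum_(u in H) \sum_(v in H | v != u) g [set u; v] = T H H.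
  by apply: eq_bigr => u _; rewrite [LHS]big_mkcondr.
have TU (A B C : {set 'I_n}) : [disjoint A & B] -> T (A :|: B) C = T A C + T B C.
  by move=> AB; rewrite /T big_disjointU.
rewrite {1}/H !TU// ![T _ H]TC !TU//.
move: (Tge _ _ _ XY hs) (Tge _ _ _ XZ ha) (Tge _ _ _ YZ hb).
move: (T0 X X) (T0 Y Y) (T0 Z Z).
rewrite (TC Y X) (TC Z X) (TC Z Y) mulr2n; lra.
Qed.
End Parts.

Lemma subset_of_card (T : finType) (A : {set T}) (m : nat) : (m <= #|A|)%N ->
  exists2 B : {set T}, B \subset A & #|B| = m.
Proof.
rewrite -bin_gt0 -cards_draws => /card_gt0P[B]; rewrite inE => /andP[BA /eqP Bm].
by exists B.
Qed.

Lemma superset_of_card (T : finType) (A : {set T}) (m : nat) :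
  (#|A| <= m <= #|T|)%N -> exists2 B : {set T}, A \subset B & #|B| = m.
Proof.
move=> Am; have [|C CA Cm] := @subset_of_card _ (~: A) (m - #|A|).
  by have := cardsC A; lia.
exists (A :|: C); first exact: finset.subsetUl.
rewrite cardsU Cm (_ : A :&: C = finset.set0) ?cards0; first by lia.
apply/eqP; rewrite setI_eq0 disjoint_sym disjoints_subset.
by rewrite (fintype.subset_trans CA)// finset.subsetT.
Qed.

(** Here x + y and z are the two halves of k, and x, y are the two halves of x + y, all up to
    rounding. The ratio 2/9 is attained at k = 6 with parts 1, 2, 3; it is the source of the
    constant 4/9. *)
Lemma quarter_square_split (k : nat) : (4 <= k)%N ->
  exists x y z, [/\ (x + y + z)%N = k, ((x + y) * z)%N = (k ^ 2 %/ 4)%N &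
                    (2 * (k ^ 2 %/ 4) <= 9 * (x * y))%N].
Proof.
move=> k4; pose c := (k %/ 4)%N; have Ek : k = (c * 4 + k %% 4)%N by exact: divn_eq.
have : (k %% 4 < 4)%N by rewrite ltn_mod.
have quarter m r : (r < 4)%N -> ((m * 4 + r) %/ 4 = m)%N.
  by move=> r4; rewrite divnMDl// divn_small// addn0.
rewrite {1 2 3 4}Ek; case: (k %% 4)%N Ek => [|[|[|[|r]]]] Ek r4; last by exfalso; lia.
all: clear r4.
- exists c, c, (2 * c)%N.
  by rewrite (_ : _ ^ 2 = 4 * c ^ 2 * 4 + 0)%N ?quarter//;
    first (split; nia); nia.
- exists c, c.+1, (2 * c)%N.
  by rewrite (_ : _ ^ 2 = (4 * c ^ 2 + 2 * c) * 4 + 1)%N ?quarter//;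
    first (split; nia); nia.
- exists c, c.+1, (2 * c).+1.
  by rewrite (_ : _ ^ 2 = (4 * c ^ 2 + 4 * c + 1) * 4 + 0)%N ?quarter//;
    first (split; nia); nia.
- exists c.+1, c.+1, (2 * c).+1.
  by rewrite (_ : _ ^ 2 = (4 * c ^ 2 + 6 * c + 2) * 4 + 1)%N ?quarter//;
    first (split; nia); nia.
Qed.

Section MonochromaticParts.
Variables (R : realDomainType) (n k : nat) (q : R).
Variables (w : {set 'I_n} -> R) (P : pred {set 'I_n}).
Hypothesis k_ge4 : (4 <= k)%N.
Hypothesis w_ge0 : forall e, e \in edges [set: 'I_n] -> 0 <= w e.
Hypothesis w_le : forall H : {set 'I_n}, #|H| = k ->
  \sum_(e in edges H | P e) w e <= q.
Let F : R := (k ^ 2 %/ 4)%N%:R.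

Let good (c : R) (u v : 'I_n) := P [set u; v] /\ c <= w [set u; v].

Lemma mono_pair_bound (X Y : {set 'I_n}) (s : R) :
  [disjoint X & Y] -> #|X| = k -> #|Y| = k -> {in X & Y, forall u v, good s u v} ->
  F * s <= q.
Proof.
move=> XY Xk Yk hs; have [x [y [z [xyzk xyz _]]]] := quarter_square_split k_ge4.
have [|X' X'X X'c] := @subset_of_card _ X (x + y); first by lia.
have [|Y' Y'Y Y'c] := @subset_of_card _ Y z; first by lia.
have := @parts_bound _ n k q w P w_ge0 w_le X' Y' finset.set0 0 0 s.
rewrite X'c Y'c cards0 !muln0 xyz !mul0r !addr0; apply=> //.
- exact: disjointWl X'X (disjointWr Y'Y XY).
- by rewrite -setI_eq0 finset.setI0.
- by rewrite -setI_eq0 finset.setI0.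
- by rewrite addn0.
- by move=> u v /(fintype.subsetP X'X) uX /(fintype.subsetP Y'Y) vY; exact: hs.
- by move=> u v _; rewrite inE.
- by move=> u v _; rewrite inE.
Qed.

(** Parts of sizes x, y, z and of sizes y, x, z both give k-sets. Adding the two bounds yields F (a
    + b) + 2xy s <= 2q, and 9xy >= 2F with s >= 0 concludes. *)
Lemma mono_triangle_bound (X Y Z : {set 'I_n}) (a b s : R) :
  [disjoint X & Y] -> [disjoint X & Z] -> [disjoint Y & Z] ->
  #|X| = k -> #|Y| = k -> #|Z| = k -> 0 <= s ->
  {in X & Y, forall u v, good s u v} ->
  {in X & Z, forall u v, good a u v} ->
  {in Y & Z, forall u v, good b u v} ->
  9 * F * (a + b) + 4 * F * s <= 18 * q.
Proof.
move=> XY XZ YZ Xk Yk Zk s0 hs ha hb.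
have [x [y [z [xyzk xyz xyF]]]] := quarter_square_split k_ge4.
have bound x' y' : (x' + y' + z)%N = k ->
    (x' * y')%:R * s + (x' * z)%:R * a + (y' * z)%:R * b <= q.
  move=> xyz'; have [|X' X'X X'c] := @subset_of_card _ X x'; first by lia.
  have [|Y' Y'Y Y'c] := @subset_of_card _ Y y'; first by lia.
  have [|Z' Z'Z Z'c] := @subset_of_card _ Z z; first by lia.
  have := @parts_bound _ n k q w P w_ge0 w_le X' Y' Z' a b s.
  rewrite X'c Y'c Z'c; apply=> //.
  - exact: disjointWl X'X (disjointWr Y'Y XY).
  - exact: disjointWl X'X (disjointWr Z'Z XZ).
  - exact: disjointWl Y'Y (disjointWr Z'Z YZ).
  - by move=> u v /(fintype.subsetP X'X) uX /(fintype.subsetP Y'Y) vY; exact: hs.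
  - by move=> u v /(fintype.subsetP X'X) uX /(fintype.subsetP Z'Z) vY; exact: ha.
  - by move=> u v /(fintype.subsetP Y'Y) uX /(fintype.subsetP Z'Z) vY; exact: hb.
have yxzk : (y + x + z)%N = k by rewrite (addnC y).
have FE : F = (x * z)%:R + (y * z)%:R by rewrite -natrD -mulnDl xyz.
have Fxy : 2 * F * s <= 9 * (x * y)%:R * s by rewrite ler_wpM2r// -!natrM ler_nat.
have := bound _ _ xyzk; have := bound _ _ yxzk; move: Fxy; rewrite FE (mulnC y x).
set xy := (x * y)%:R; set xz := (x * z)%:R; set yz := (y * z)%:R.
lra.
Qed.
End MonochromaticParts.

(** * The lower bound *)

Section PairWeight.
Variables (R : numDomainType) (n : nat) (w : {set 'I_n} -> R).

(** The value 0 on the diagonal makes tuples with repeated vertices harmless, since [w] is arbitrary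
    on singletons. *)
Definition pair_weight (u v : 'I_n) : R := if u == v then 0 else w [set u; v].

Lemma pair_weightC u v : pair_weight u v = pair_weight v u.
Proof. by rewrite /pair_weight eq_sym finset.setUC. Qed.

Lemma sum_pair_weight : \sum_(e in edges [set: 'I_n]) w e = 'C(n, 2)%:R ->
  \sum_u \sum_v pair_weight u v = n%:R * (n%:R - 1).
Proof.
move=> ws; transitivity ((\sum_(e in edges [set: 'I_n]) w e) *+ 2).
  rewrite -sum_pairs_edges; apply: eq_big => [u|u _]; first by rewrite inE.
  rewrite [RHS]big_mkcond; apply: eq_bigr => v _.
  by rewrite inE /= /pair_weight eq_sym; case: eqP.
rewrite ws -mulrnA; have := mul_bin_left n 1; rewrite bin1.
case: n => [|m]; first by rewrite mul0r.
by rewrite mulnC => ->; rewrite subn1 /= mulnC natrM -natr1 addrK.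
Qed.

(** An edge extends to a k-set, where its weight is one of the nonnegative terms of the sum for its
    own colour. *)
Lemma pair_weight_bounds (k : nat) (q : R) (red : {set {set 'I_n}}) :
  (2 <= k <= n)%N ->
  (forall e, e \in edges [set: 'I_n] -> 0 <= w e) ->
  (forall H : {set 'I_n}, #|H| = k ->
     \sum_(e in edges H | e \in red) w e <= q /\
     \sum_(e in edges H | e \notin red) w e <= q) ->
  forall u v, 0 <= pair_weight u v <= q.
Proof.
move=> k2n w0 h u v.
have edge_le e : e \in edges [set: 'I_n] -> w e <= q.
  rewrite inE => /andP[_ /eqP e2].
  have [|H eH Hk] := @superset_of_card _ e k; first by rewrite e2 card_ord.
  have eE : e \in edges H by rewrite inE eH e2 eqxx.
  have wH e' : e' \in edges H -> 0 <= w e'.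
    by rewrite inE => /andP[_ e'2]; apply: w0; rewrite inE finset.subsetT.
  have [hr hb] := h H Hk.
  have [er|er] := boolP (e \in red); [apply: le_trans hr|apply: le_trans hb];
    rewrite (bigD1 e) ?eE ?er//= lerDl sumr_ge0// => e' /andP[/andP[e'H _] _];
    exact: wH.
have q0 : 0 <= q.
  have [|H _ Hk] := @superset_of_card _ (finset.set0 : {set 'I_n}) k.
    by rewrite cards0 card_ord; case/andP: k2n.
  have [hr _] := h H Hk; apply: le_trans hr; apply: sumr_ge0 => e /andP[+ _].
  by rewrite inE => /andP[_ e2]; apply: w0; rewrite inE finset.subsetT.
rewrite /pair_weight; case: eqP => [_|/eqP uv]; first by rewrite lexx q0.
have E : [set u; v] \in edges [set: 'I_n] by rewrite inE finset.subsetT cards2 uv.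
by rewrite w0// edge_le.
Qed.
End PairWeight.

Lemma admissible_ge (R : realType) (k : nat) : (4 <= k)%N ->
  exists N, forall n (q : R), (N <= n)%N -> admissible n k q ->
  106 / 100 * (k ^ 2 %/ 4)%N%:R <= q.
Proof.
move=> k4; set F := (k ^ 2 %/ 4)%N.
have F4 : (4 <= F)%N by rewrite /F leq_divRL//; nia.
(* [B] is an integer bound on q, and [m] the largest index when weights up to [B] are rounded down
   to multiples of 1/1000. *)
pose B := (2 * F)%N; pose m := (1000 * B)%N.
have [||N HN] := @homogeneous_blowup (bool * bool * 'I_m.+1)%type 6 (1500 * B) k.
- by rewrite /B; lia.
- by lia.
exists (maxn N (maxn 1500 k)) => n q; rewrite !geq_max => /and3P[Nn n1500 kn].
move=> [w [red [w0 ws h]]]; rewrite leNgt; apply/negP => qF.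
have F0 : 4 <= F%:R :> R by rewrite ler_nat.
have qB : q < B%:R by rewrite /B natrM; lra.
pose f := pair_weight w.
have f_bounds u v : 0 <= f u v <= q.
  by apply: pair_weight_bounds w0 h u v; lia.
have f0 u v : 0 <= f u v by case/andP: (f_bounds u v).
have fq u v : f u v <= q by case/andP: (f_bounds u v).
pose A := [set x : 6.-tuple 'I_n | (1498 / 100 <= pair_sum f x)%R]%SET.
have A_large : (n ^ 6 <= 1500 * B * #|A|)%N.
  have := @dense_heavy_tuples R 'I_n f B; rewrite card_ord; apply=> //.
    by move=> u v; apply: le_trans (fq u v) (ltW qB).
  exact: sum_pair_weight.
pose bucket u v := Num.truncn (1000 * f u v).
have bucket_lt u v : (bucket u v < m.+1)%N.
  rewrite ltnS -(ler_nat R).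
  have /andP[] := truncn_itv (mulr_ge0 (ler0n R 1000) (f0 u v)).
  move=> /le_trans + _; apply; rewrite /m natrM ler_pM2l ?ltr0n//.
  exact: le_trans (fq u v) (ltW qB).
(* Besides the colour and the rounded weight, [c] records equality. This forces the parts to be
   disjoint: if u were in both [S i] and [S j], another u' in [S i] would give [c u' u] =
   [c u u]. *)
pose c u v := (u == v, [set u; v]%SET \in red, Ordinal (bucket_lt u v)).
have [S [kappa [Sk hc SA]]] := HN n c A Nn A_large.
have cS (i j : 'I_6) u v : i != j -> u \in S i -> v \in S j -> c u v = kappa i j.
  by move=> ij uS vS; exact: hc.
have Sne (i j : 'I_6) u v : i != j -> u \in S i -> v \in S j -> u != v.
  move=> ij uS vS; apply/eqP => uv; rewrite -{v}uv in vS.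
  have [u' u'S u'u] : exists2 u', u' \in S i & u' != u.
    have : (0 < #|S i :\ u|)%N.
      by move: (cardsD1 u (S i)); rewrite uS Sk; clear -k4; lia.
    by case/card_gt0P => u'; rewrite !inE => /andP[? ?]; exists u'.
  have := cS i j u' u ij u'S vS; rewrite -(cS i j u u ij uS vS) => -[].
  by rewrite eqxx (negbTE u'u).
have Sdis (i j : 'I_6) : i != j -> [disjoint S i & S j].
  move=> ij; apply/pred0P => u /=; apply/andP => -[ui uj].
  by have := Sne i j u u ij ui uj; rewrite eqxx.
have S_gt0 i : (0 < #|S i|)%N by rewrite Sk (leq_trans _ k4).
pose x i := xchoose (fintype.card_gt0P (S_gt0 i)).
have xS i : x i \in S i by exact: xchooseP.
(* By homogeneity the representatives [x i] determine colour and bucket between the parts. Rounding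
   down makes [beta] a lower bound for all weights there, short by at most 1/1000. *)
pose beta i j : R := (bucket (x i) (x j))%:R / 1000.
pose col i j := [set x i; x j]%SET \in red.
have betaC i j : beta i j = beta j i by rewrite /beta /bucket /f pair_weightC.
have colC i j : col i j = col j i by rewrite /col finset.setUC.
have beta0 i j : 0 <= beta i j by rewrite divr_ge0.
have bucketS i j u v : (i < 6)%N -> (j < 6)%N -> i != j -> u \in S i -> v \in S j ->
    bucket u v = bucket (x i) (x j) /\ ([set u; v]%SET \in red) = col i j.
  move=> i6 j6 ij uS vS; have ij' : Ordinal i6 != Ordinal j6 by [].
  have := cS _ _ u v ij' uS vS; rewrite -(cS _ _ (x i) (x j) ij' (xS i) (xS j)).
  by case=> _ -> ->.
pose P (b : bool) (e : {set 'I_n}) := (e \in red) == b.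
have hP b (H : {set 'I_n}) : #|H| = k -> \sum_(e in edges H | P b e) w e <= q.
  move=> /h[hr hb]; case: b.
    by rewrite (eq_bigl _ _ (fun e => congr1 (andb _) (eqb_id _))).
  by rewrite (eq_bigl _ _ (fun e => congr1 (andb _) (eqbF_neg _))).
have good i j : (i < 6)%N -> (j < 6)%N -> i != j ->
    {in S i & S j, forall u v, P (col i j) [set u; v] /\ beta i j <= w [set u; v]}.
  move=> i6 j6 ij u v uS vS; have [Eb Ec] := bucketS i j u v i6 j6 ij uS vS.
  rewrite /P Ec eqxx; split=> //.
  have uv : u != v by apply: (Sne (Ordinal i6) (Ordinal j6)).
  have <- : f u v = w [set u; v] by rewrite /f /pair_weight (negbTE uv).
  rewrite /beta -Eb ler_pdivrMr ?ltr0n// mulrC.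
  by have /andP[] := truncn_itv (mulr_ge0 (ler0n R 1000) (f0 u v)).
have dis i j : (i < 6)%N -> (j < 6)%N -> i != j -> [disjoint S i & S j].
  by move=> i6 j6 ij; apply: (Sdis (Ordinal i6) (Ordinal j6)).
have FP : 0 < F%:R :> R by exact: lt_le_trans F0.
have tri i j l : (i < 6)%N -> (j < 6)%N -> (l < 6)%N -> uniq [:: i; j; l] ->
    col i j = col i l -> col i j = col j l ->
    beta i l + beta j l + 4 / 9 * beta i j <= 2 * (106 / 100).
  move=> i6 j6 l6; rewrite /= !inE negb_or => /andP[/andP[ij il]]; rewrite andbT => jl.
  move=> cil cjl.
  have gil := good _ _ i6 l6 il; rewrite -cil in gil.
  have gjl := good _ _ j6 l6 jl; rewrite -cjl in gjl.
  have := mono_triangle_bound k4 w0 (hP _) (dis _ _ i6 j6 ij) (dis _ _ i6 l6 il)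
    (dis _ _ j6 l6 jl) (Sk i) (Sk j) (Sk l) (beta0 _ _) (good _ _ i6 j6 ij) gil gjl.
  rewrite -/F => bnd; rewrite -(ler_pM2l FP); move: bnd; clear -qF; lra.
have edge i j : (i < j < 6)%N -> beta i j <= 106 / 100.
  move=> /andP[ij j6]; have i6 := ltn_trans ij j6.
  have ij' : i != j by rewrite ltn_eqF.
  have := mono_pair_bound k4 w0 (hP _) (dis _ _ i6 j6 ij') (Sk i) (Sk j)
    (good _ _ i6 j6 ij').
  rewrite -/F => bnd; rewrite -(ler_pM2l FP); move: bnd; clear -qF; lra.
have := K6_weight edge betaC colC tri.
have : [tuple x 0; x 1; x 2; x 3; x 4; x 5] \in A.
  apply: SA => i; rewrite (tnth_nth (x 0)).
  by case: i => -[|[|[|[|[|[|//]]]]]] /= _; exact: xS.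
rewrite inE /= !big_cons !big_nil => heavy.
have near i j : f (x i) (x j) <= beta i j + 1 / 1000.
  have /andP[_ /ltW] := truncn_itv (mulr_ge0 (ler0n R 1000) (f0 (x i) (x j))).
  rewrite -(natr1 (Num.truncn _)) /beta /bucket; clear; lra.
(* The contradiction is 14.98 <= (127/9) 1.06 + 15/1000 < 14.973. *)
move: heavy (near 0%N 1%N) (near 0%N 2%N) (near 0%N 3%N) (near 0%N 4%N)
  (near 0%N 5%N)
  (near 1%N 2%N) (near 1%N 3%N) (near 1%N 4%N) (near 1%N 5%N) (near 2%N 3%N)
  (near 2%N 4%N) (near 2%N 5%N)
  (near 3%N 4%N) (near 3%N 5%N) (near 4%N 5%N).
rewrite /rank_ends /=; clear; lra.
Qed.

(** * Constructions *)

Lemma card_bigcup_le (I T : finType) (P : pred I) (A : I -> {set T}) :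
  (#|\bigcup_(i | P i) A i| <= \sum_(i | P i) #|A i|)%N.
Proof.
elim/big_rec2: _ => [|i m B _ le]; first by rewrite cards0.
by apply: leq_trans (leq_card_setU _ _) _; rewrite leq_add2l.
Qed.

(** Let u have maximum degree D in H. Its neighbourhood is independent, so every edge has an
    endpoint among the |H| - D other vertices, each of degree at most D; and D(|H| - D) <=
    |H|^2/4. *)
Lemma mantel n (H : {set 'I_n}) (P : pred {set 'I_n}) :
  (forall u v l, u != v -> u != l -> v != l ->
     P [set u; v] -> P [set u; l] -> P [set v; l] -> False) ->
  (#|[set e in edges H | P e]| <= #|H| ^ 2 %/ 4)%N.
Proof.
move=> tri_free; have [->|[u0 u0H]] := set_0Vmem H.
  rewrite (_ : [set e in _ | _] = finset.set0) ?cards0//; apply/setP => e; rewrite !inE.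
  rewrite finset.subset0; case: (eqVneq e finset.set0) => // ->.
  by rewrite cards0.
pose N u := [set v in H | (v != u) && P [set u; v]].
case: (@arg_maxnP _ u0 (mem H) (fun u => #|N u|) u0H) => u uH u_max.
have edges_sub : [set e in edges H | P e] \subset
    \bigcup_(v in H :\: N u) [set [set v; l] | l in N v].
  apply/fintype.subsetP => e; rewrite !inE.
  move=> /andP[/andP[eH /cards2P[a [b [ab E]]]] Pe].
  move: eH Pe; rewrite E subUset !sub1set => /andP[aH bH] Pab.
  have [aN|aN] := boolP (a \in N u); last first.
    apply/bigcupP; exists a; first by rewrite inE aN.
    by apply: imset_f; rewrite inE bH eq_sym ab.
  apply/bigcupP; exists b; last first.
    apply/imsetP; exists a; last by rewrite finset.setUC.
    by rewrite inE aH ab finset.setUC.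
  rewrite inE bH andbT; apply/negP => bN; move: aN bN; rewrite !inE.
  move=> /and3P[_ au Pua] /and3P[_ bu Pub].
  by apply: (tri_free u a b) => //; rewrite eq_sym.
have NH : N u \subset H by apply/fintype.subsetP => v; rewrite inE => /andP[].
apply: leq_trans (subset_leq_card edges_sub) _.
apply: leq_trans (card_bigcup_le _ _) _.
apply: (@leq_trans (\sum_(v in H :\: N u) #|N u|)).
  apply: leq_sum => v; rewrite inE => /andP[_ vH].
  by apply: leq_trans (leq_imset_card _ _) _; exact: u_max.
rewrite sum_nat_const cardsD (setIidPr NH) leq_divRL//.
by rewrite mulnC -{2}(subnK (subset_leq_card NH)) nat_AGM2.
Qed.

Lemma card_residue (m r a : nat) : (a < r)%N ->
  #|[set v : 'I_(m * r) | v %% r == a]%N| = m.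
Proof.
move=> ar; pose F i := if (i %% r == a)%N then 1%N else 0%N.
rewrite -sum1dep_card big_mkcond /= -(big_mkord xpredT F).
elim: m => [|m IH]; first by rewrite big_nil.
rewrite mulSnr (@big_cat_nat _ _ _ (m * r))//= ?leq_addr// IH.
rewrite -{1}[(m * r)%N]add0n big_addn addKn big_mkord.
rewrite (bigD1 (Ordinal ar))//= /F (addnC a) modnMDl modn_small// eqxx.
rewrite big1 ?addn0 ?addn1//.
move=> i ia; rewrite (addnC (i : nat)) modnMDl modn_small//.
by case: eqP => // Ei; case/eqP: ia; apply: val_inj.
Qed.

Section ResidueColouring.
Variables (m r : nat) (rho : rel nat).
Hypothesis rho_sym : symmetric rho.
Hypothesis rho_irr : irreflexive rho.

(** An edge is an unordered set, so its endpoints are quantified; symmetry and irreflexivity of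
    [rho] make the result depend on the two residues only. *)
Definition residue_edge (e : {set 'I_(m * r)}) : bool :=
  [exists u in e, exists v in e, rho (u %% r)%N (v %% r)%N].

Lemma residue_edgeE u v : residue_edge [set u; v] = rho (u %% r)%N (v %% r)%N.
Proof.
apply/exists_inP/idP => [[a + /exists_inP[b]]|uv].
  rewrite !inE => /orP[]/eqP -> /orP[]/eqP ->; rewrite ?rho_irr//.
  by rewrite rho_sym.
by exists u; rewrite ?inE ?eqxx//; apply/exists_inP; exists v; rewrite ?inE ?eqxx ?orbT.
Qed.
End ResidueColouring.

Lemma sum_residue_pairs (V : zmodType) (m r : nat) (a b : V) (u : 'I_(m * r)) :
  (0 < r)%N ->
  \sum_(v in [set: 'I_(m * r)] | v != u) (if (u %% r == v %% r)%N then a else b) =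
  a *+ (m - 1) + b *+ (m * r - m).
Proof.
move=> r0; pose same := [set v : 'I_(m * r) | v %% r == u %% r]%N.
have card_same : #|same| = m by rewrite card_residue// ltn_mod.
rewrite (bigID (mem same)) /=; congr (_ + _).
  rewrite (eq_bigr (fun=> a)) => [|v /andP[_]]; last by rewrite inE eq_sym => ->.
  rewrite sumr_const; congr (_ *+ _).
  transitivity #|same :\ u|.
    by apply: eq_card => v; rewrite !inE unfold_in /= !inE.
  by move: (cardsD1 u same); rewrite card_same inE eqxx; clear; lia.
rewrite (eq_bigr (fun=> b)) => [|v /andP[_]]; last first.
  by rewrite inE eq_sym => /negbTE ->.
rewrite sumr_const; congr (_ *+ _).
transitivity #|~: same|.
  apply: eq_card => v; rewrite !inE unfold_in /= !inE.
  by case: (eqVneq v u) => [->|]; rewrite ?eqxx ?andbF.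
by move: (cardsC same); rewrite card_ord card_same; clear; lia.
Qed.

(** Every vertex has weighted degree (m - 1) a + (mr - m) b, so the total is right once this equals
    mr - 1. *)
Lemma total_residue_weight (R : numDomainType) (m r : nat) (a b : R)
    (w : {set 'I_(m * r)} -> R) : (0 < r)%N ->
  (forall u v, w [set u; v] = if (u %% r == v %% r)%N then a else b) ->
  (m * r)%:R * (a *+ (m - 1) + b *+ (m * r - m)) = ((m * r)%:R * (m * r).-1%:R) ->
  \sum_(e in edges [set: 'I_(m * r)]) w e = 'C(m * r, 2)%:R.
Proof.
move=> r0 wE tot; apply: (@mulIf _ 2); first by rewrite pnatr_eq0.
rewrite mulr_natr -sum_pairs_edges.
rewrite (eq_bigr (fun=> a *+ (m - 1) + b *+ (m * r - m))) => [|u _]; last first.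
  by under eq_bigr do rewrite wE; exact: sum_residue_pairs.
rewrite sumr_const cardsT card_ord -[LHS]mulr_natl tot -!natrM.
by have := mul_bin_left (m * r) 1; rewrite bin1 subn1 mulnC => ->; rewrite mulnC.
Qed.

Lemma neq_residue_sym : symmetric (fun i j : nat => i != j).
Proof. by move=> i j; rewrite eq_sym. Qed.

Lemma neq_residue_irr : irreflexive (fun i j : nat => i != j).
Proof. by move=> i; rewrite eqxx. Qed.

(* Red joins residues differing by 1 modulo 5 and blue those differing by 2:
   both are pentagons, hence triangle-free, and so are their blow-ups. *)
Definition pentagon (i j : nat) : bool :=
  (j == i.+1 %% 5)%N || (i == j.+1 %% 5)%N.

Lemma pentagon_admissible (R : realType) (k m : nat) : (0 < m)%N ->
  admissible (m * 5) k (125 / 100 * (k ^ 2 %/ 4)%N%:R : R).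
Proof.
move=> m0; have m1 : 1 <= m%:R :> R by rewrite ler1n.
have m4 : 0 < 4 * m%:R :> R by lra.
(* Each vertex has 4m neighbours in other classes, so this weight makes its weighted degree 5m -
   1. *)
pose al : R := (5 * m%:R - 1) / (4 * m%:R).
have al0 : 0 <= al by rewrite divr_ge0// ?ltW//; lra.
have al_le : al <= 125 / 100 by rewrite ler_pdivrMr//; lra.
pose cross := @residue_edge m 5 (fun i j => i != j).
pose rd := @residue_edge m 5 (fun i j => (i != j) && pentagon i j).
have crossE u v : cross [set u; v] = (u %% 5 != v %% 5)%N.
  by apply: residue_edgeE; [exact: neq_residue_sym|exact: neq_residue_irr].
have rdE u v : rd [set u; v] = (u %% 5 != v %% 5)%N && pentagon (u %% 5) (v %% 5).
  apply: residue_edgeE => [i j|i]; last by rewrite eqxx.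
  by rewrite eq_sym /pentagon orbC.
pose w e := if cross e then al else 0.
have residue5 (p : nat -> nat -> nat -> bool) :
    all (fun i => all (fun j => all (p i j) (iota 0 5)) (iota 0 5)) (iota 0 5) ->
    forall u v l : nat, p (u %% 5)%N (v %% 5)%N (l %% 5)%N.
  move=> + u v l; have I x : (x %% 5)%N \in iota 0 5 by rewrite mem_iota ltn_mod.
  by move=> /allP/(_ _ (I u))/allP/(_ _ (I v))/allP/(_ _ (I l)).
(* In either colour only crossing edges carry weight, and they form a triangle-free graph: Mantel's
   theorem bounds their number. *)
have bound (P : pred {set 'I_(m * 5)}) (H : {set 'I_(m * 5)}) : #|H| = k ->
    (forall u v l, u != v -> u != l -> v != l -> cross [set u; v] && P [set u; v] ->
      cross [set u; l] && P [set u; l] -> cross [set v; l] && P [set v; l] -> False) ->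
    \sum_(e in edges H | P e) w e <= 125 / 100 * (k ^ 2 %/ 4)%N%:R.
  move=> Hk tri_free; have := @mantel _ H (fun e => cross e && P e) tri_free.
  rewrite Hk -(ler_nat R) => le; apply: (@le_trans _ _ (al * (k ^ 2 %/ 4)%N%:R)).
    apply: le_trans (ler_wpM2l al0 le); rewrite mulr_natr -sumr_const.
    rewrite big_mkcond [leRHS]big_mkcond /=; apply: ler_sum => e _.
    rewrite !inE /w; case: (e \subset H) => //=; case: (#|e| == 2%N) => //=.
    by case: (P e); case: (cross e).
  by rewrite ler_wpM2r.
exists w, [set e | rd e]%SET; split=> [e _||H Hk].
- by rewrite /w; case: ifP.
- apply: (@total_residue_weight _ m 5 0 al) => //.
    by move=> u v; rewrite /w crossE; case: eqP.
  rewrite mul0rn add0r; congr (_ * _).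
  rewrite (_ : (m * 5 - m)%N = (4 * m)%N); last by lia.
  rewrite -[al *+ _]mulr_natr natrM divfK ?gt_eqF// -subn1 natrB; last by lia.
  by rewrite natrM mulrC.
split; apply: bound => // u v l uv ul vl; rewrite !inE !crossE !rdE.
- have := @residue5 (fun i j h => ~~ [&& (i != j) && ((i != j) && pentagon i j),
    (i != h) && ((i != h) && pentagon i h) &
    (j != h) && ((j != h) && pentagon j h)]) isT u v l.
  by move=> /negP + h1 h2 h3; apply; rewrite h1 h2 h3.
- have := @residue5 (fun i j h => ~~ [&& (i != j) && ~~ ((i != j) && pentagon i j),
    (i != h) && ~~ ((i != h) && pentagon i h) &
    (j != h) && ~~ ((j != h) && pentagon j h)]) isT u v l.
  by move=> /negP + h1 h2 h3; apply; rewrite h1 h2 h3.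
Qed.

Lemma bipartite_admissible (R : realType) (m : nat) : (0 < m)%N ->
  admissible (m * 2) 4 (48 / 10 : R).
Proof.
move=> m0; have m1 : 1 <= m%:R :> R by rewrite ler1n.
have m5 : 0 < 5 * m%:R :> R by lra.
(* Solves (m - 1) 4/5 + m al = 2m - 1. The two colours balance: a 4-set has at most 6 red edges of
   weight 4/5 and, by Mantel's theorem, at most 4 blue edges of weight at most 6/5, and both
   products are 4.8. *)
pose al : R := 6 / 5 - 1 / (5 * m%:R).
have al0 : 0 <= al by rewrite subr_ge0 ler_pdivrMr//; lra.
have al_le : al <= 6 / 5 by rewrite gerBl divr_ge0// ltW.
pose cross := @residue_edge m 2 (fun i j => i != j).
have crossE u v : cross [set u; v] = (u %% 2 != v %% 2)%N.
  by apply: residue_edgeE; [exact: neq_residue_sym|exact: neq_residue_irr].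
pose w e := if cross e then al else 4 / 5.
have w0 e : 0 <= w e by rewrite /w; case: ifP => // _; lra.
exists w, [set e | ~~ cross e]%SET; split=> [e _//||H Hk].
- apply: (@total_residue_weight _ m 2 (4 / 5) al) => //.
    by move=> u v; rewrite /w crossE; case: eqP.
  congr (_ * _); rewrite (_ : (m * 2 - m)%N = m); last by lia.
  rewrite -[al *+ _]mulr_natr -[(4 / 5) *+ _]mulr_natr -subn1 !natrB ?natrM; [|lia|lia].
  by rewrite /al; field; rewrite gt_eqF//; lra.
split.
  apply: (@le_trans _ _ (\sum_(e in edges H) (4 / 5))).
    rewrite big_mkcondr; apply: ler_sum => e _.
    by rewrite inE /w; case: (cross e) => //=; lra.
  by rewrite sumr_const card_edges Hk -[leLHS]mulr_natr (_ : 'C(4, 2) = 6%N)//; lra.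
have tri_free (u v l : 'I_(m * 2)) : u != v -> u != l -> v != l ->
    cross [set u; v] -> cross [set u; l] -> cross [set v; l] -> False.
  rewrite !crossE; lia.
have := @mantel _ H cross tri_free.
rewrite Hk -(ler_nat R) (_ : 4 ^ 2 %/ 4 = 4)%N// => le.
apply: (@le_trans _ _ (6 / 5 * #|[set e in edges H | cross e]|%:R)); last by lra.
rewrite mulr_natr -sumr_const.
rewrite big_mkcond [leRHS]big_mkcond /=; apply: ler_sum => e _.
rewrite !inE /w; case: (e \subset H) => //=; case: (#|e| == 2%N) => //=.
by case: (cross e).
Qed.

(** * The limit *)

From mathcomp Require Import all_classical all_reals all_analysis.
Import numFieldNormedType.Exports.

Section Limit.
Variables (R : realType) (k : nat).
Hypothesis k_ge4 : (4 <= k)%N.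

Lemma wR_mono (n m : nat) : (k <= n)%N -> (n <= m)%N -> wR R n k <= wR R m k.
Proof.
move=> kn; elim: m => [|m IH]; first by rewrite leqn0 => /eqP ->.
rewrite leq_eqVlt => /predU1P[->//|]; rewrite ltnS => nm.
by apply: le_trans (IH nm) _; apply: wR_nondecreasing; lia.
Qed.

Lemma W_cvg : cvgn (fun n => wR R n k).
Proof. by apply: wR_cvg; lia. Qed.

Lemma W_ge : 106 / 100 * (k ^ 2 %/ 4)%N%:R <= W R k.
Proof.
have [N HN] := admissible_ge R k_ge4; apply: limr_ge; first exact: W_cvg.
near=> n; apply: (HN n); first by near: n; exact: nbhs_infty_ge.
(* The infimum is attained, so [wR] is itself an admissible value. *)
by apply: (@wR_min R n k _).1; near: n; exact: nbhs_infty_ge.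
Unshelve. all: by end_near. Qed.

(** Constructions on multiples of [r] suffice, because [wR] at n is at most [wR] at nr by
    monotonicity. *)
Lemma W_le (r : nat) (q : R) : (0 < r)%N ->
  (forall m, (0 < m)%N -> admissible (m * r) k q) -> W R k <= q.
Proof.
move=> r0 adm; apply: limr_le; first exact: W_cvg.
near=> n; have kn : (k <= n)%N by near: n; exact: nbhs_infty_ge.
apply: le_trans (@wR_mono n (n * r) kn _) _; first by rewrite leq_pmulr.
apply: (wR_min R _).2; first by rewrite (leq_trans kn)// leq_pmulr.
by apply: adm; lia.
Unshelve. all: by end_near. Qed.

Lemma W_le_pentagon : W R k <= 125 / 100 * (k ^ 2 %/ 4)%N%:R.
Proof. by apply: (@W_le 5) => // m; exact: pentagon_admissible. Qed.
End Limit.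

Theorem theorem4 (R : realType) :
  [/\ forall k : nat, (5 <= k)%N ->
        1051 / 1000 * (k ^ 2 %/ 4)%N%:R < W R k /\
        W R k <= 125 / 100 * (k ^ 2 %/ 4)%N%:R,
      exists k0 : nat, forall k : nat, (k0 <= k)%N ->
        1059 / 1000 * (k ^ 2 %/ 4)%N%:R < W R k &
      [/\ 4 + 1999 / 10 ^+ 4 <= W R 4 <= 48 / 10,
          6 + 3572 / 10 ^+ 4 <= W R 5 <= 75 / 10,
          9 + 5197 / 10 ^+ 4 <= W R 6 <= 1125 / 100,
          12 + 7091 / 10 ^+ 4 <= W R 7 <= 15 &
          16 + 9115 / 10 ^+ 4 <= W R 8 <= 20]].
Proof.
have lower (k : nat) (c : R) : (4 <= k)%N -> c < 106 / 100 ->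
    c * (k ^ 2 %/ 4)%N%:R < W R k.
  move=> k4 c_lt; apply: lt_le_trans (W_ge R k4); rewrite ltr_pM2r// ltr0n.
  by rewrite divn_gt0// (leq_trans _ (leq_mul k4 k4)).
have two_sided (k F : nat) (l u : R) : (4 <= k)%N -> (k ^ 2 %/ 4)%N = F ->
    l <= 106 / 100 * F%:R -> 125 / 100 * F%:R <= u -> l <= W R k <= u.
  move=> k4 <- lF Fu; apply/andP; split; first exact: le_trans (W_ge R k4).
  exact: le_trans (W_le_pentagon R k4) _.
split.
- move=> k k5; have k4 := ltnW k5.
  by split; [apply: lower => //; lra|exact: W_le_pentagon].
(* The bound 1.06 F holds from k = 4 on, so no larger threshold is called for. *)
- by exists 4%N => k k4; apply: lower => //; lra.
split.
- apply/andP; split.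
    by apply: le_trans (W_ge R (leqnn 4)); rewrite (_ : 4 ^ 2 %/ 4 = 4)%N//; lra.
  (* The pentagon would only give 5 here. *)
  by apply: (@W_le R 4 _ 2) => // m; exact: bipartite_admissible.
- by apply: (@two_sided 5 6) => //; lra.
- by apply: (@two_sided 6 9) => //; lra.
- by apply: (@two_sided 7 12) => //; lra.
- by apply: (@two_sided 8 16) => //; lra.
Qed.
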